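(* Let $(T,d)$ be a complete metric space, let $\alpha>0$, for each $t\in T$ let $\mathcal{H}_t$ be a Hilbert space and let $A_t$ be a bounded self-adjoint linear operator on $\mathcal{H}_t$, such that $\sup_{t\in T}\|A_t\|<\infty$. (i) If $A=(A_t)_{t\in T}$ is a p2-$\alpha$-Hölder continuous field, then the map $t\mapsto\sigma(A_t)$ is $\alpha/2$-Hölder continuous with respect to the Hausdorff metric. (ii) If the map $t\mapsto\sigma(A_t)$ is $\alpha$-Hölder continuous with respect to the Hausdorff metric, then $A$ is a p2-$\alpha$-Hölder continuous field.
   Context: $\sigma(B)$ denotes the spectrum of $B$. Hölder functions: for metric spaces $(X,d_X)$, $(Y,d_Y)$ and $\alpha>0$, a function $f:X\to Y$ is $\alpha$-Hölder (continuous) if $\mathrm{Hol}^\alpha(f)=\sup_{x\neq y}\frac{d_Y(f(x),f(y))}{d_X(x,y)^\alpha}<\infty$. A family $\mathcal{F}$ of functions $X\to Y$ is uniformly $\alpha$-Hölder if $\sup_{f\in\mathcal{F}}\mathrm{Hol}^\alpha(f)<\infty$. p2-$\alpha$-Hölder fields: for $M>0$ let $\mathscr{P}_2(M)$ be the set of polynomials $p(z)=p_0+p_1z+p_2z^2$ with $p_i\in\mathbb{R}$ and $\|p\|_1=|p_0|+|p_1|+|p_2|\le M$. The field $A$ is p2-$\alpha$-Hölder continuous if for every $M>0$ the maps $\Phi_p:t\in T\mapsto\|p(A_t)\|$, $p\in\mathscr{P}_2(M)$, are uniformly $\alpha$-Hölder. Hausdorff metric: for $x\in\mathbb{R}$ and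 $F,G\subset\mathbb{R}$, $\mathrm{dist}(x,F)=\inf\{|x-y| : y\in F\}$, $\delta(F,G)=\sup_{x\in F}\mathrm{dist}(x,G)$ and $d_H(F,G)=\max\{\delta(F,G),\delta(G,F)\}$. *)

(* Defs.v *)
From HB Require Import structures.
From mathcomp Require Import all_boot all_order all_algebra complex.
From mathcomp Require Import all_classical all_reals all_analysis.
From mathcomp Require Import sesquilinear.

Set Implicit Arguments.
Unset Strict Implicit.
Unset Printing Implicit Defensive.

Import Order.TTheory GRing.Theory Num.Theory.
Import numFieldNormedType.Exports.

Local Open Scope classical_set_scope.
Local Open Scope ring_scope.
Local Open Scope complex_scope.

#[short(type="completeMetricType")]
HB.structure Definition CompleteMetric (R : realType) :=
  { T of Metric R T & Complete T }.

(* Complex Hilbert spaces.  The inner product is linear in its first and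
   conjugate-linear in its second argument. *)
HB.mixin Record CompleteNormedModule_isHilbert (R : realType) H
    & CompleteNormedModule R[i] H := {
  inner : {dot H for @Num.conj R[i]} ;
  inner_norm : forall x : H, inner x x = `|x| ^+ 2
}.

#[short(type="hilbertType")]
HB.structure Definition Hilbert (R : realType) :=
  { H of CompleteNormedModule R[i] H & CompleteNormedModule_isHilbert R H }.

Section operators.
Context {R : realType} {H : hilbertType R}.
Implicit Types B C : H -> H.

(* MathComp norms over R[i] take values in R[i]; this is the same number,
   read in R. *)
Definition rnorm (x : H) : R := complex.Re `|x|.

Definition bounded_operator B := exists M : R, forall x, rnorm (B x) <= M * rnorm x.

Definition self_adjoint B := forall x y, inner (B x) y = inner x (B y).

(* Only used for bounded operators: sup is 0 on sets that are not bounded. *)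
Definition opnorm B : R := sup [set rnorm (B x) | x in [set x | rnorm x <= 1]].

Definition resolvent_set B : set R[i] := [set l | exists C : {linear H -> H},
  [/\ bounded_operator C, forall x, C (B x - l *: x) = x
    & forall x, B (C x) - l *: C x = x]].

Definition spectrum B : set R[i] := ~` resolvent_set B.

Definition poly_operator (p : {poly R}) B (x : H) : H :=
  \sum_(i < size p) (p`_i)%:C *: iter i B x.

End operators.

(* On the zero space the spectrum is empty, so that its Hausdorff distance to
   a nonempty set is +oo. *)
Definition nontrivial {R : realType} (H : hilbertType R) := exists x : H, x != 0.

Section holder.
Context {R : realType} {X : metricType R} {Y : Type}.
Local Open Scope ereal_scope.

(* The distance of the codomain is a parameter with values in \bar R, because
   the Hausdorff distance may be infinite.  On a domain with at most one point
   the supremum is -oo. *)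
Definition holder_const (alpha : R) (dY : Y -> Y -> \bar R) (f : X -> Y) : \bar R :=
  ereal_sup [set dY (f z.1) (f z.2) * ((mdist z.1 z.2 `^ alpha)^-1)%:E
            | z in [set z : X * X | z.1 <> z.2]].

Definition holder alpha dY (f : X -> Y) : Prop := holder_const alpha dY f < +oo.

Definition uniformly_holder alpha dY (F : set (X -> Y)) : Prop :=
  ereal_sup [set holder_const alpha dY f | f in F] < +oo.

End holder.

Section hausdorff_distance.
Context {R : realType}.
Implicit Types F G : set R[i].
Local Open Scope ereal_scope.

(* Distances are taken in the complex plane, because spectrum is a set of
   complex numbers; for sets of reals they are those of the real line. *)
Definition dist_set (x : R[i]) F : \bar R :=
  ereal_inf [set (complex.Re `|x - y|%R)%:E | y in F].

Definition hausdorff_excess F G : \bar R := ereal_sup [set dist_set x G | x in F].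

Definition hausdorff_dist F G : \bar R :=
  maxe (hausdorff_excess F G) (hausdorff_excess G F).

End hausdorff_distance.

Section p2_holder.
Context {R : realType}.

Definition P2 (M : R) : set {poly R} :=
  [set p : {poly R} | (size p <= 3)%N /\ `|p`_0| + `|p`_1| + `|p`_2| <= M].

Definition real_dist (x y : R) : \bar R := (`|x - y|)%:E.

Definition p2_holder {T : metricType R} (alpha : R) (H : T -> hilbertType R)
    (A : forall t, H t -> H t) :=
  forall M : R, 0 < M -> uniformly_holder alpha real_dist
    [set (fun t => opnorm (poly_operator p (A t))) | p in P2 M].

End p2_holder.

(* Main.v *)
From HB Require Import structures.
Require Import Defs.
From mathcomp Require Import all_boot all_order all_algebra complex.
From mathcomp Require Import all_classical all_reals all_analysis.
From mathcomp Require Import sesquilinear ring lra.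

Set Implicit Arguments.
Unset Strict Implicit.
Unset Printing Implicit Defensive.

Import Order.TTheory GRing.Theory Num.Theory.
Import numFieldNormedType.Exports.

Local Open Scope classical_set_scope.
Local Open Scope ring_scope.

(** The theorem rests on one identity for a bounded self-adjoint operator A on
a nonzero Hilbert space and a real polynomial p: the norm of p(A) is the
maximum of |p| over the spectrum of A.  It splits into two halves,
[horner_le_opnorm] (no value exceeds the norm) and [opnorm_attained] (some
value reaches it).

Both halves come from the description of the spectrum by approximate
eigenvectors, [self_adjoint_spectrumP]: l is in the spectrum exactly when
A - l is not bounded below.  The substantial direction says that if A - l is
bounded below, then it is onto.  Since A - l is normal, its adjoint B' is also
bounded below, and then x |-> x - t B (B' x), with B = A - l, is a strict
contraction for a small t > 0, so that B (B' x) = y is solved by a fixed point.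
The values |p(a)| are then at most the norm of p(A), by testing p(A) on
approximate eigenvectors.  For the other half, put m = ||p(A)||.  Since p(A) is
self-adjoint, p(A)^2 - m^2 is not bounded below
([opnorm_sqr_approx_eigenvalue]).  Over the complex numbers the
polynomial p^2 - m^2 splits into linear factors, so some factor A - l is not
bounded below: l is in the spectrum and |p(l)| = m.

For (i), let N bound all the norms and let a be in the spectrum of A_s.  The
quadratic q(z) = (2N)^2 - (z - a)^2 is nonnegative on [-N, N] and peaks at a,
so ||q(A_s)|| >= (2N)^2, whereas ||q(A_t)|| = (2N)^2 - (b - a)^2 for some b in
the spectrum of A_t.  The square of the distance from a to b is therefore
bounded by the difference of the norms, which is of order d(s,t)^alpha; the
square root is what halves the exponent.  The coefficients of q are bounded in
terms of N only, so one family P2 M serves for all a.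

For (ii), the polynomials of P2 M are Lipschitz on [-N, N] with a common
constant, and a value of |p| that reaches ||p(A_s)|| is approximated by values
of |p| on the spectrum of A_t, all of them at most ||p(A_t)||. *)

(** * The real-valued norm and the real inner product *)

Section real_norm.
Local Open Scope complex_scope.
Context {R : realType} {H : hilbertType R}.
Implicit Types (x y z : H) (l : R[i]) (a : R).

Lemma norm_rnorm x : `|x| = (rnorm x)%:C.
Proof. by apply/esym/RRe_real/ger0_real. Qed.

Lemma rnorm_ge0 x : 0 <= rnorm x.
Proof. by rewrite -ler0c -norm_rnorm. Qed.

Lemma rnorm0 : rnorm (0 : H) = 0.
Proof. by rewrite /rnorm normr0. Qed.

Lemma rnorm_gt0 x : (0 < rnorm x) = (x != 0).
Proof. by rewrite -ltcR -norm_rnorm normr_gt0. Qed.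

Lemma rnormD x y : rnorm (x + y) <= rnorm x + rnorm y.
Proof. by rewrite -lecR rmorphD /= -!norm_rnorm ler_normD. Qed.

Lemma rnormN x : rnorm (- x) = rnorm x.
Proof. by rewrite /rnorm normrN. Qed.

Lemma rnormZ l x : rnorm (l *: x) = complex.Re `|l| * rnorm x.
Proof.
apply: (@complexI R); rewrite rmorphM /= -!norm_rnorm normrZ.
by congr (_ * _); apply/esym/RRe_real/ger0_real.
Qed.

Lemma normC_real a : complex.Re `|a%:C| = `|a|.
Proof. by rewrite normc_def /= expr0n addr0 sqrtr_sqr. Qed.

Lemma rnormZr a x : rnorm (a%:C *: x) = `|a| * rnorm x.
Proof. by rewrite rnormZ normC_real. Qed.

Definition rinner x y : R := complex.Re (inner x y).

Lemma rinnerxx x : rinner x x = rnorm x ^+ 2.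
Proof. by rewrite /rinner inner_norm norm_rnorm -rmorphXn. Qed.

Lemma innerC x y : inner x y = (inner y x)^*%C.
Proof. by rewrite hermC expr0 mul1r. Qed.

Lemma innerBl x y z : inner (x - y) z = inner x z - inner y z.
Proof. by rewrite linearBl. Qed.

Lemma innerBr x y z : inner z (x - y) = inner z x - inner z y.
Proof. by rewrite linearB. Qed.

Lemma innerZl l x y : inner (l *: x) y = l * inner x y.
Proof. by rewrite linearZl_LR. Qed.

Lemma innerZr l x y : inner x (l *: y) = l^*%C * inner x y.
Proof. by rewrite linearZ. Qed.

Lemma rinnerC x y : rinner x y = rinner y x.
Proof. by rewrite /rinner innerC; case: (inner y x). Qed.

Lemma rnormB_sqr x y :
  rnorm (x - y) ^+ 2 = rnorm x ^+ 2 - 2 * rinner x y + rnorm y ^+ 2.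
Proof.
rewrite -!rinnerxx.
have -> : rinner (x - y) (x - y) =
    rinner x x - rinner x y - (rinner y x - rinner y y).
  rewrite /rinner innerBl !innerBr.
  by do 4![case: (inner _ _) => ? ?].
by rewrite (rinnerC y); ring.
Qed.

Lemma rinnerZr a x y : rinner x (a%:C *: y) = a * rinner x y.
Proof.
rewrite /rinner innerZr; case: (inner x y) => u v /=.
by rewrite oppr0 mul0r subr0.
Qed.

(** Balls of H have radii in R[i]; a positive complex number is a positive real
one, so Cauchy sequences can be tested with real radii. *)
Lemma complete_seq (u : nat -> H) :
  (forall e : R, 0 < e -> exists N, forall n m, (N <= n)%N -> (N <= m)%N ->
     rnorm (u n - u m) < e) ->
  exists x, forall e : R, 0 < e -> exists N, forall n, (N <= n)%N ->
     rnorm (x - u n) < e.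
Proof.
move=> uC.
have toR (e : R[i]) : 0 < e -> exists2 r : R, 0 < r & e = r%:C.
  case: e => r s; rewrite ltcE /= => /andP[/eqP -> r0].
  by exists r.
have /cauchy_cvgP : cauchy (u @ \oo).
  apply/cauchy_ballP => e /toR[r r0 ->]; near_simpl.
  have [N NP] := uC r r0.
  exists ([set n | N <= n]%N, [set n | N <= n]%N); first by split; exists N.
  move=> [n m] [/= Nn Nm]; rewrite -ball_normE /= norm_rnorm ltcR.
  exact: NP.
move=> /cvg_ex[x /cvgrPdist_lt ux]; exists x => e e0.
have [|N _ NP] := ux e%:C; first by rewrite ltcR.
by exists N => n /NP; rewrite norm_rnorm ltcR.
Qed.

(** The contraction principle, for the real-valued norm on a space whose scalars
are complex. *)
Lemma contraction_fixpoint (f : H -> H) (q : R) : 0 <= q -> q < 1 ->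
  (forall x y, rnorm (f x - f y) <= q * rnorm (x - y)) -> exists x, f x = x.
Proof.
move=> q0 q1 fq.
(* Two almost fixed points are close to each other; for the iterates, this
   yields the Cauchy property without summing a geometric series. *)
have post x y : rnorm (x - y) <= (rnorm (f x - x) + rnorm (f y - y)) / (1 - q).
  rewrite ler_pdivlMr ?subr_gt0 //.
  have := fq x y.
  have : rnorm (x - y) <= rnorm (f x - x) + rnorm (f x - f y) + rnorm (f y - y).
    rewrite (_ : x - y = - (f x - x) + (f x - f y) + (f y - y)); last first.
      by rewrite opprB !addrA subrK subrK.
    by rewrite -[rnorm (f x - x)]rnormN (le_trans (rnormD _ _)) ?lerD2r ?rnormD.
  lra.
pose u n := iter n f 0; pose D := rnorm (f 0).
have D0 : 0 <= D by exact: rnorm_ge0.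
have uq n : rnorm (f (u n) - u n) <= q ^+ n * D.
  elim: n => [|n IH]; first by rewrite /u /= subr0 expr0 mul1r.
  by rewrite exprS -mulrA (le_trans (fq _ _)) // ler_wpM2l.
have qlim e : 0 < e -> exists N, forall n, (N <= n)%N -> q ^+ n * D < e.
  move=> e0.
  have eD : 0 < e / (D + 1) by rewrite divr_gt0 // ltr_wpDl.
  have : q ^+ n @[n --> \oo] --> (0 : R) by apply: cvg_expr; rewrite ger0_norm.
  move=> /cvgrPdist_lt /(_ _ eD)[N _ NP]; exists N => n /NP.
  rewrite sub0r normrN ger0_norm ?exprn_ge0 // => qn.
  have : q ^+ n * (D + 1) < e by rewrite -ltr_pdivlMr // ltr_wpDl.
  by apply: le_lt_trans; rewrite ler_wpM2l ?exprn_ge0 // lerDl.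
have [|x ux] := @complete_seq u.
  move=> e e0; have [|N NP] := qlim (e * (1 - q) / 2).
    by rewrite divr_gt0 // mulr_gt0 // subr_gt0.
  exists N => n m /NP n1 /NP m1.
  rewrite (le_lt_trans (post _ _)) // ltr_pdivrMr ?subr_gt0 //.
  have := uq n; have := uq m; lra.
exists x; apply/eqP; rewrite -subr_eq0 -[_ == _]negbK -rnorm_gt0 -leNgt.
apply/ler_addgt0Pl => e e0; rewrite addr0.
have [|N NP] := ux (e / 2); first by rewrite divr_gt0.
rewrite (_ : f x - x = (f x - f (u N)) - (x - u N.+1)); last first.
  by rewrite /u /= opprB addrA subrK.
rewrite (le_trans (rnormD _ _)) // rnormN.
have := fq x (u N); have := NP N (leqnn _); have := NP N.+1 (leqnSn _).
have := rnorm_ge0 (x - u N).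
nra.
Qed.

End real_norm.

(** * Bounded below operators and the spectrum *)

Section self_adjoint.
Local Open Scope complex_scope.
Context {R : realType} {H : hilbertType R}.
Implicit Types (x y z : H) (l : R[i]) (a b : R).

Lemma bounded_operator_gt0 (B : H -> H) : bounded_operator B ->
  exists2 M : R, 0 < M & forall x, rnorm (B x) <= M * rnorm x.
Proof.
move=> [M BM]; exists (`|M| + 1); first by rewrite ltr_wpDl.
move=> x; rewrite (le_trans (BM x)) // ler_wpM2r ?rnorm_ge0 //.
by rewrite (le_trans (ler_norm M)) // lerDl.
Qed.

Definition bounded_below (B : H -> H) :=
  exists2 c : R, 0 < c & forall x, c * rnorm x <= rnorm (B x).

(** This replaces the orthogonal projection argument for surjectivity.  If B is
bounded by K and B' is bounded below by c, then expanding the square gives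
||x - t B B' x||^2 <= (1 - t c^2) ||x||^2 for t = K^-2, so that the map
x |-> x - t (B B' x - y) has a fixed point, and B B' x = y there. *)
Lemma adjoint_bounded_below_surjective (B B' : {linear H -> H}) :
  (forall x y, inner (B x) y = inner x (B' y)) ->
  bounded_operator B -> bounded_below B' -> forall y, exists x, B x = y.
Proof.
move=> adj /bounded_operator_gt0[M M0 BM] [c c0 Bc] y.
(* Adding c to the bound M makes t c^2 <= 1, so that the square root below is
   that of a nonnegative number. *)
pose K := M + c; have K0 : 0 < K by rewrite addr_gt0.
have BK x : rnorm (B x) <= K * rnorm x.
  by rewrite (le_trans (BM x)) // ler_wpM2r ?rnorm_ge0 // lerDl ltW.
pose t := (K ^+ 2)^-1; have t0 : 0 < t by rewrite invr_gt0 exprn_gt0.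
have tK : t * K ^+ 2 = 1 by rewrite mulVf // gt_eqF // exprn_gt0.
pose f x := x - t%:C *: (B (B' x) - y).
have tc : t * c ^+ 2 <= 1.
  by rewrite -tK ler_wpM2l ?(ltW t0) // ler_pXn2r ?nnegrE ?ltW // ltrDr.
pose q := Num.sqrt (1 - t * c ^+ 2).
have q1 : q < 1.
  rewrite -[ltRHS]sqrtr1 ltr_sqrt ?ltr01 // gtrBl.
  by rewrite mulr_gt0 // exprn_gt0.
have contr z : rnorm (z - t%:C *: B (B' z)) <= q * rnorm z.
  rewrite -(@ler_pXn2r _ 2) ?nnegrE ?mulr_ge0 ?sqrtr_ge0 ?rnorm_ge0 //.
  rewrite exprMn sqr_sqrtr ?subr_ge0 // rnormB_sqr rinnerZr rnormZr.
  rewrite (gtr0_norm t0) rinnerC {1}/rinner adj -/(rinner _ _) rinnerxx.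
  have nB := BK (B' z); have nc := Bc z.
  have h1 : rnorm (B (B' z)) ^+ 2 <= K ^+ 2 * rnorm (B' z) ^+ 2.
    rewrite -exprMn ler_pXn2r ?nnegrE ?rnorm_ge0 //.
    by rewrite mulr_ge0 ?rnorm_ge0 // ltW.
  have h2 : c ^+ 2 * rnorm z ^+ 2 <= rnorm (B' z) ^+ 2.
    rewrite -exprMn ler_pXn2r ?nnegrE ?rnorm_ge0 //.
    by rewrite mulr_ge0 ?rnorm_ge0 // ltW.
  have {}h1 := ler_wpM2l (ltW (mulr_gt0 t0 t0)) h1.
  have {}h2 := ler_wpM2l (ltW t0) h2.
  have e1 : t * t * (K ^+ 2 * rnorm (B' z) ^+ 2) = t * rnorm (B' z) ^+ 2.
    by rewrite -[in RHS](mulr1 t) -tK; ring.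
  rewrite e1 in h1; rewrite exprMn; lra.
have [|x fx] := @contraction_fixpoint _ _ f q (sqrtr_ge0 _) q1.
  move=> u v; rewrite /f.
  rewrite (_ : _ - _ = (u - v) - t%:C *: B (B' (u - v))) //.
  rewrite !linearB /= !opprK addrACA; congr (_ + _).
  by rewrite addrACA subrr addr0.
exists (B' x); move/eqP: fx.
rewrite /f -subr_eq0 addrC addKr oppr_eq0 scaler_eq0.
case/orP => /eqP; last exact: subr0_eq.
by move=> /(@complexI R) t_eq0; rewrite t_eq0 ltxx in t0.
Qed.

Lemma bounded_below_resolvent (B : {linear H -> H}) l :
  bounded_below (fun x => B x - l *: x) ->
  (forall y, exists x, B x - l *: x = y) -> resolvent_set B l.
Proof.
move=> [c c0 Bc] Bsurj.
pose Bl x := B x - l *: x.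
have BlD (a : R[i]) x y : Bl (a *: x + y) = a *: Bl x + Bl y.
  rewrite /Bl linearP /= scalerDr scalerBr !scalerA (mulrC l) opprD.
  by rewrite addrACA.
have Bl_inj x y : Bl x = Bl y -> x = y.
  move=> e; apply/eqP; rewrite -subr_eq0 -[_ == _]negbK -rnorm_gt0 -leNgt.
  have := Bc (x - y); rewrite -/(Bl _).
  have -> : Bl (x - y) = 0.
    by rewrite addrC -scaleN1r BlD e scaleN1r addNr.
  by rewrite rnorm0 pmulr_rle0.
pose C y := sval (cid (Bsurj y)).
have CK y : Bl (C y) = y by rewrite /C; case: cid.
have Clin : linear C by move=> a x y; apply: Bl_inj; rewrite BlD !CK.
pose CLm := GRing.isLinear.Build _ _ _ _ C Clin.
pose CL : {linear H -> H} := HB.pack C CLm.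
exists CL; split => [|x|x]; last exact: CK.
- exists c^-1 => x; rewrite -ler_pdivrMl ?invr_gt0 // invrK.
  by rewrite -[leRHS](congr1 rnorm (CK x)) // Bc.
- by apply: Bl_inj; rewrite CK.
Qed.

Lemma self_adjoint_real (A : H -> H) x : self_adjoint A ->
  complex.Im (inner (A x) x) = 0.
Proof.
by move=> A_sa; move: (innerC (A x) x); rewrite -A_sa;
  case: (inner _ _) => u v [] /= ?; lra.
Qed.

(** The cross term of the square vanishes: (A - a) x is paired with i b x, and
the inner product of (A - a) x with x is real. *)
Lemma self_adjoint_shift_norm (A : {linear H -> H}) a b x : self_adjoint A ->
  rnorm (A x - (a +i* b) *: x) ^+ 2 =
  rnorm (A x - a%:C *: x) ^+ 2 + b ^+ 2 * rnorm x ^+ 2.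
Proof.
move=> A_sa.
have Da_sa : self_adjoint (fun x => A x - a%:C *: x).
  move=> u v; rewrite innerBl innerBr innerZl innerZr A_sa.
  by rewrite conjc_real.
have -> : A x - (a +i* b) *: x = A x - a%:C *: x - (0 +i* b) *: x.
  by rewrite -addrA -opprD -scalerDl; congr (_ - _ *: _); simpc.
rewrite rnormB_sqr.
have -> : rinner (A x - a%:C *: x) ((0 +i* b) *: x) = 0.
  have := self_adjoint_real x Da_sa.
  rewrite /rinner innerZr; case: (inner _ _) => u v /= ->.
  by rewrite mul0r mulr0 subr0.
rewrite rnormZ normc_def /= expr0n add0r sqrtr_sqr exprMn.
rewrite real_normK ?num_real //.
by rewrite mulr0 subr0.
Qed.

(** A - l is normal, so it and its adjoint have the same norm at each vector. *)
Lemma self_adjoint_shift_conj (A : {linear H -> H}) l x : self_adjoint A ->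
  rnorm (A x - l^*%C *: x) = rnorm (A x - l *: x).
Proof.
move=> A_sa; case: l => a b; rewrite [conjc _]/=.
apply/eqP; rewrite -(@eqrXn2 _ 2) ?rnorm_ge0 //; apply/eqP.
rewrite (self_adjoint_shift_norm a b x A_sa).
by rewrite (self_adjoint_shift_norm a (- b) x A_sa) sqrrN.
Qed.

(** A self-adjoint operator has no residual spectrum: as soon as A - l is
bounded below, so is its adjoint, and A - l is onto.  Conversely, a bounded
inverse gives a lower bound. *)
Lemma self_adjoint_spectrumP (A : {linear H -> H}) l :
  bounded_operator A -> self_adjoint A ->
  spectrum A l <-> ~ bounded_below (fun x => A x - l *: x).
Proof.
move=> A_bd A_sa; split; last first.
  move=> notbb [C [/bounded_operator_gt0[M M0 CM] CK _]]; apply: notbb.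
  exists M^-1 => [|x]; first by rewrite invr_gt0.
  by rewrite ler_pdivrMl // -[in leLHS](CK x) CM.
move=> spl bb; apply: spl; apply: bounded_below_resolvent => //.
pose B : {linear H -> H} := A \- l \*: idfun.
pose B' : {linear H -> H} := A \- l^*%C \*: idfun.
apply: (@adjoint_bounded_below_surjective B B').
- by move=> x y; rewrite /= innerBl innerBr innerZl innerZr A_sa conjcK.
- have [M M0 AM] := bounded_operator_gt0 A_bd.
  exists (M + complex.Re `|l|) => x /=.
  rewrite (le_trans (rnormD _ _)) // rnormN rnormZ mulrDl.
  by rewrite lerD2r.
- have [c c0 Bc] := bb; exists c => // x.
  by rewrite /B' /= self_adjoint_shift_conj.
Qed.

(** If l = a + i b with b != 0, then A - l is bounded below by |b|, by
[self_adjoint_shift_norm]. *)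
Lemma self_adjoint_spectrum_real (A : {linear H -> H}) l :
  bounded_operator A -> self_adjoint A -> spectrum A l ->
  exists a, l = a%:C.
Proof.
move=> A_bd A_sa /(self_adjoint_spectrumP _ A_bd A_sa) notbb.
case: l notbb => a b notbb; exists a; have [-> //|b0] := eqVneq b 0.
exfalso; apply: notbb; exists `|b| => [|x]; first by rewrite normr_gt0.
rewrite -(@ler_pXn2r _ 2) ?nnegrE ?mulr_ge0 ?rnorm_ge0 //.
rewrite self_adjoint_shift_norm // exprMn real_normK ?num_real //.
by rewrite lerDr sqr_ge0.
Qed.

(** * The operator norm *)

Lemma opnorm_le (B : H -> H) (M : R) : 0 <= M ->
  (forall x, rnorm (B x) <= M * rnorm x) -> opnorm B <= M.
Proof.
move=> M0 BM; apply: ge_sup.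
  by exists (rnorm (B 0)), 0 => //=; rewrite rnorm0.
move=> _ [x /= x1 <-]; rewrite (le_trans (BM x)) //.
by rewrite -[leRHS]mulr1 ler_wpM2l.
Qed.

Lemma rnorm_le_opnorm (B : {linear H -> H}) x :
  bounded_operator B -> rnorm (B x) <= opnorm B * rnorm x.
Proof.
move=> /bounded_operator_gt0[M M0 BM].
have [->|x0] := eqVneq x 0; first by rewrite linear0 !rnorm0 mulr0.
have nx : 0 < rnorm x by rewrite rnorm_gt0.
rewrite -ler_pdivrMr //.
have nB : rnorm (B ((rnorm x)^-1%:C *: x)) = rnorm (B x) / rnorm x.
  by rewrite linearZ /= rnormZr gtr0_norm ?invr_gt0 // mulrC.
rewrite -nB; apply: ub_le_sup; last first.
  exists ((rnorm x)^-1%:C *: x) => //=.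
  by rewrite rnormZr gtr0_norm ?invr_gt0 // mulVf ?gt_eqF.
exists M => _ [z /= z1 <-]; rewrite (le_trans (BM z)) //.
by rewrite -[leRHS]mulr1 ler_wpM2l // ltW.
Qed.

Lemma opnorm_ge0 (B : {linear H -> H}) : bounded_operator B -> 0 <= opnorm B.
Proof.
move=> /bounded_operator_gt0[M M0 BM]; apply: ub_le_sup; last first.
  by exists 0; rewrite /= ?linear0 ?rnorm0.
exists M => _ [z /= z1 <-]; rewrite (le_trans (BM z)) //.
by rewrite -[leRHS]mulr1 ler_wpM2l // ltW.
Qed.

(** * Polynomials of an operator *)

(** Complex coefficients are needed to split a real polynomial of A into linear
factors. *)
Definition peval (q : {poly R[i]}) (A : H -> H) x : H :=
  \sum_(i < size q) q`_i *: iter i A x.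

Lemma peval_widen (n : nat) (q : {poly R[i]}) (A : H -> H) x :
  (size q <= n)%N -> peval q A x = \sum_(i < n) q`_i *: iter i A x.
Proof.
move=> qn; rewrite /peval (big_ord_widen n (fun i => q`_i *: iter i A x)) //.
rewrite big_mkcond /=; apply: eq_bigr => i _; case: ltnP => // qi.
by rewrite nth_default // scale0r.
Qed.

Lemma poly_operatorE (p : {poly R}) (A : H -> H) :
  poly_operator p A = peval (map_poly (real_complex R) p) A.
Proof.
apply/funext => x; rewrite /peval size_map_poly.
by apply: eq_bigr => i _; rewrite coef_map.
Qed.

Lemma pevalD (p q : {poly R[i]}) (A : H -> H) x :
  peval (p + q) A x = peval p A x + peval q A x.
Proof.
pose n := maxn (size p) (size q).
rewrite !(@peval_widen n) ?leq_maxl ?leq_maxr ?size_polyD //.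
by rewrite -big_split; apply: eq_bigr => i _; rewrite coefD scalerDl.
Qed.

Lemma pevalZ l (q : {poly R[i]}) (A : H -> H) x :
  peval (l *: q) A x = l *: peval q A x.
Proof.
rewrite !(@peval_widen (size q)) ?size_scale_leq //.
by rewrite scaler_sumr; apply: eq_bigr => i _; rewrite coefZ scalerA.
Qed.

Lemma peval1 (A : H -> H) x : peval 1 A x = x.
Proof. by rewrite /peval size_poly1 big_ord1 coef1 scale1r. Qed.

Lemma pevalC l (A : H -> H) x : peval l%:P A x = l *: x.
Proof. by rewrite -[l%:P]mulr1 mul_polyC pevalZ peval1. Qed.

Lemma pevalMX (q : {poly R[i]}) (A : H -> H) x :
  peval (q * 'X) A x = peval q A (A x).
Proof.
rewrite (@peval_widen (size q).+1); last first.
  by rewrite (leq_trans (size_polyMleq _ _)) // size_polyX addn2.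
rewrite big_ord_recl coefMX /= scale0r add0r; apply: eq_bigr => i _.
by rewrite coefMX /= -iterSr.
Qed.

Lemma peval_XsubC l (A : H -> H) x : peval ('X - l%:P) A x = A x - l *: x.
Proof.
by rewrite -polyCN pevalD -['X]mul1r pevalMX peval1 pevalC scaleNr.
Qed.

Lemma peval_commute (q : {poly R[i]}) (A : {linear H -> H}) x :
  peval q A (A x) = A (peval q A x).
Proof.
rewrite /peval linear_sum /=; apply: eq_bigr => i _.
by rewrite linearZ /= -iterSr.
Qed.

Lemma pevalM (p q : {poly R[i]}) (A : {linear H -> H}) x :
  peval (p * q) A x = peval p A (peval q A x).
Proof.
elim/poly_ind: p x => [|p c IH] x.
  by rewrite mul0r -[0](scale0r 1) !pevalZ !scale0r.
rewrite mulrDl !pevalD -mulrA (mulrC 'X) mulrA !pevalMX IH pevalC.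
by rewrite peval_commute mul_polyC pevalZ.
Qed.

Lemma peval_linear (q : {poly R[i]}) (A : {linear H -> H}) :
  linear (peval q A).
Proof.
elim/poly_ind: q => [|q c IH] k x y.
  by rewrite -[0](scale0r 1) !pevalZ !scale0r scaler0 addr0.
rewrite !pevalD !pevalMX !pevalC linearP IH scalerDr !scalerA (mulrC c).
by rewrite addrACA scalerDr scalerA.
Qed.

HB.instance Definition _ (q : {poly R[i]}) (A : {linear H -> H}) :=
  GRing.isLinear.Build _ _ _ _ (peval q A) (peval_linear q A).

Lemma peval_bounded (q : {poly R[i]}) (A : H -> H) :
  bounded_operator A -> bounded_operator (peval q A).
Proof.
move=> /bounded_operator_gt0[M M0 AM].
elim/poly_ind: q => [|q c /bounded_operator_gt0[K K0 qK]].
  by exists 0 => x; rewrite -[0](scale0r 1) pevalZ scale0r rnorm0 mul0r.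
exists (K * M + complex.Re `|c|) => x.
rewrite pevalD pevalMX pevalC (le_trans (rnormD _ _)) // rnormZ mulrDl lerD2r.
by rewrite (le_trans (qK _)) // -mulrA ler_wpM2l // ltW.
Qed.

Lemma peval_self_adjoint (p : {poly R}) (A : {linear H -> H}) :
  self_adjoint A -> self_adjoint (peval (map_poly (real_complex R) p) A).
Proof.
move=> A_sa; elim/poly_ind: p => [|p c IH] x y.
  by rewrite rmorph0 -[0](scale0r 1) !pevalZ !scale0r linear0l linear0.
rewrite rmorphD rmorphM /= map_polyX map_polyC /= !pevalD !pevalMX !pevalC.
rewrite linearDl linearD /= IH A_sa peval_commute innerZl innerZr.
by rewrite conjc_real.
Qed.

(** * Spectral mapping for the norm *)

(** Let p - p(a) = q (X - a).  On approximate eigenvectors x for a, the vector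
p(A) x - p(a) x = q(A) (A x - a x) is small, so that |p(a)| is almost reached
by ||p(A) x|| / ||x||. *)
Lemma horner_le_opnorm (A : {linear H -> H}) (p : {poly R}) a :
  bounded_operator A -> self_adjoint A -> spectrum A a%:C ->
  `|p.[a]| <= opnorm (poly_operator p A).
Proof.
move=> A_bd A_sa /(self_adjoint_spectrumP _ A_bd A_sa) notbb.
rewrite poly_operatorE; set P := map_poly _ p.
have /factor_theorem[Q PQ] : root (P - (p.[a])%:C%:P) a%:C.
  by rewrite /root !hornerE horner_map subrr.
have [K K0 QK] := bounded_operator_gt0 (peval_bounded Q A_bd).
apply/ler_addgt0Pr => e e0; rewrite leNgt; apply/negP => lt_p.
(* If |p(a)| >= ||p(A)|| + e, then q(A) maps A x - a x to a vector of norm at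
   least e ||x||, so that K ||A x - a x|| >= e ||x||. *)
apply: notbb; exists (e / K) => [|x]; first by rewrite divr_gt0.
have Px : (p.[a])%:C *: x = peval P A x - peval Q A (A x - a%:C *: x).
  apply/eqP; rewrite eq_sym subr_eq -(pevalC _ A); apply/eqP.
  by rewrite -peval_XsubC -pevalM -PQ -pevalD addrC subrK.
have := rnormZr p.[a] x; rewrite Px => nx.
have := rnormD (peval P A x) (- peval Q A (A x - a%:C *: x)).
rewrite nx rnormN.
have := rnorm_le_opnorm x (peval_bounded P A_bd).
have := QK (A x - a%:C *: x) => h1 h2 h3.
rewrite mulrAC ler_pdivrMr // [leRHS]mulrC.
have := ler_wpM2r (rnorm_ge0 x) (ltW lt_p); lra.
Qed.

Lemma spectrum_le_opnorm (A : {linear H -> H}) a :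
  bounded_operator A -> self_adjoint A -> spectrum A a%:C -> `|a| <= opnorm A.
Proof.
move=> A_bd A_sa Aa; have := horner_le_opnorm 'X A_bd A_sa Aa.
rewrite hornerX poly_operatorE map_polyX.
suff -> : peval 'X A = A by [].
by apply/funext => x; rewrite -['X]mul1r pevalMX peval1.
Qed.

(** Expanding the square,
||B^2 x - m^2 x||^2 <= m^2 (m^2 ||x||^2 - ||B x||^2) for m = ||B||.
A lower bound c for B^2 - m^2 would therefore keep ||B x||^2 under
(m^2 - c^2 / m^2) ||x||^2, against the choice of m. *)
Lemma opnorm_sqr_approx_eigenvalue (B : {linear H -> H}) :
  nontrivial H -> bounded_operator B -> self_adjoint B ->
  ~ bounded_below (fun x => B (B x) - (opnorm B ^+ 2)%:C *: x).
Proof.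
move=> [z z0] B_bd B_sa [c c0 Bc].
set m := opnorm B in Bc *.
have m0 : 0 <= m by exact: opnorm_ge0.
have Bm x : rnorm (B x) <= m * rnorm x by exact: rnorm_le_opnorm.
have key x : c ^+ 2 * rnorm x ^+ 2 <=
    m ^+ 2 * (m ^+ 2 * rnorm x ^+ 2 - rnorm (B x) ^+ 2).
  have h1 : c ^+ 2 * rnorm x ^+ 2 <=
      rnorm (B (B x) - (m ^+ 2)%:C *: x) ^+ 2.
    rewrite -exprMn ler_pXn2r ?nnegrE ?rnorm_ge0 //.
    by rewrite mulr_ge0 ?rnorm_ge0 // ltW.
  have h2 : rnorm (B (B x)) ^+ 2 <= m ^+ 2 * rnorm (B x) ^+ 2.
    rewrite -exprMn ler_pXn2r ?nnegrE ?rnorm_ge0 //.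
    by rewrite mulr_ge0 ?rnorm_ge0.
  move: h1; rewrite rnormB_sqr rinnerZr rnormZr ger0_norm ?sqr_ge0 //.
  rewrite {1}/rinner B_sa -/(rinner _ _) rinnerxx exprMn; lra.
have nz : 0 < rnorm z by rewrite rnorm_gt0.
have m_gt0 : 0 < m.
  rewrite lt_neqAle m0 andbT eq_sym; apply/eqP => m_eq0.
  have := key z; rewrite m_eq0 expr0n mul0r => /(lt_le_trans _) h.
  by have := h 0; rewrite mulr_gt0 ?exprn_gt0 // ltxx => /(_ isT).
pose s := m ^+ 2 - c ^+ 2 / m ^+ 2.
have keys x : rnorm (B x) ^+ 2 <= s * rnorm x ^+ 2.
  rewrite -(ler_pM2l (exprn_gt0 2 m_gt0)).
  have -> : m ^+ 2 * (s * rnorm x ^+ 2) =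
      m ^+ 2 * (m ^+ 2 * rnorm x ^+ 2) - c ^+ 2 * rnorm x ^+ 2.
    by rewrite /s; field; rewrite gt_eqF.
  have := key x; lra.
have s0 : 0 <= s.
  rewrite -(@pmulr_lge0 _ (rnorm z ^+ 2)) ?exprn_gt0 //.
  exact: le_trans (sqr_ge0 _) (keys z).
have : m <= Num.sqrt s.
  apply: opnorm_le => [|x]; first exact: sqrtr_ge0.
  rewrite -(@ler_pXn2r _ 2) ?nnegrE ?mulr_ge0 ?sqrtr_ge0 ?rnorm_ge0 //.
  by rewrite exprMn sqr_sqrtr.
rewrite leNgt => /negP; apply.
rewrite -(@ltr_pXn2r _ 2) ?nnegrE ?sqrtr_ge0 // sqr_sqrtr // /s gtrBl.
by rewrite divr_gt0 ?exprn_gt0.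
Qed.

Lemma bounded_below_comp (B C : H -> H) :
  bounded_below B -> bounded_below C -> bounded_below (B \o C).
Proof.
move=> [b b0 Bb] [c c0 Cc]; exists (b * c) => [|x]; first exact: mulr_gt0.
by rewrite (le_trans _ (Bb _)) // -mulrA ler_wpM2l // ltW.
Qed.

(** If A - l were bounded below for each root l of Q, then so would be Q(A),
a product of such factors and a nonzero scalar. *)
Lemma spectrum_root (A : {linear H -> H}) (Q : {poly R[i]}) :
  bounded_operator A -> self_adjoint A -> Q != 0 ->
  ~ bounded_below (peval Q A) -> exists2 l, spectrum A l & root Q l.
Proof.
move=> A_bd A_sa Q0 notbb; apply: contrapT => norm_root.
have [r Qr] := closed_field_poly_normal Q.
have c0 : lead_coef Q != 0 by rewrite lead_coef_eq0.
have r_bb l : l \in r -> bounded_below (fun x => A x - l *: x).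
  move=> lr; apply: contrapT => /(self_adjoint_spectrumP _ A_bd A_sa) Al.
  apply: norm_root; exists l => //.
  by rewrite Qr rootZ // root_prod_XsubC.
apply: notbb; rewrite Qr -mul_polyC.
have -> : peval ((lead_coef Q)%:P * \prod_(z <- r) ('X - z%:P)) A =
    ( *:%R (lead_coef Q)) \o peval (\prod_(z <- r) ('X - z%:P)) A.
  by apply/funext => x; rewrite pevalM pevalC.
apply: bounded_below_comp.
  exists (complex.Re `|lead_coef Q|) => [|x]; last by rewrite rnormZ.
  rewrite -ltcR; have -> : (complex.Re `|lead_coef Q|)%:C = `|lead_coef Q|.
    by apply/RRe_real/ger0_real.
  by rewrite normr_gt0.
elim: r {Qr} r_bb => [|l r IH] r_bb.
  rewrite big_nil; exists 1 => // x; by rewrite peval1 mul1r.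
rewrite big_cons.
have -> : peval (('X - l%:P) * \prod_(z <- r) ('X - z%:P)) A =
    (fun x => A x - l *: x) \o peval (\prod_(z <- r) ('X - z%:P)) A.
  apply/funext => x; rewrite pevalM /=.
  by rewrite peval_XsubC.
apply: bounded_below_comp; first by apply: r_bb; rewrite mem_head.
by apply: IH => k kr; apply: r_bb; rewrite inE kr orbT.
Qed.

(** [spectrum_root] for Q = p^2 - ||p(A)||^2.  This Q vanishes if p is
constant; then each point of the spectrum will do, and the case p = X shows
that there is one. *)
Lemma opnorm_attained (A : {linear H -> H}) (p : {poly R}) :
  nontrivial H -> bounded_operator A -> self_adjoint A ->
  exists2 a, spectrum A a%:C & `|p.[a]| = opnorm (poly_operator p A).
Proof.
move=> Hnt A_bd A_sa.
pose m (q : {poly R}) := opnorm (poly_operator q A).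
pose P (q : {poly R}) := map_poly (real_complex R) q.
pose Q q := P q * P q - (m q ^+ 2)%:C%:P.
have m0 q : 0 <= m q.
  by rewrite /m poly_operatorE; apply: opnorm_ge0; exact: peval_bounded.
have norm_attained q a : root (Q q) a%:C -> `|q.[a]| = m q.
  rewrite /root !hornerE horner_map -rmorphM -rmorphB /=.
  move=> /eqP/(@complexI R)/eqP; rewrite subr_eq0 -expr2 => /eqP qm.
  by apply/eqP; rewrite -(@eqrXn2 _ 2) // real_normK ?num_real // qm.
have attained q : Q q != 0 -> exists2 a, spectrum A a%:C & root (Q q) a%:C.
  move=> /(spectrum_root A_bd A_sa)[|l Al Ql].
    have -> : peval (Q q) A = (fun x => peval (P q) A (peval (P q) A x) -
        (m q ^+ 2)%:C *: x).
      by apply/funext => x; rewrite /Q -polyCN pevalD pevalM pevalC scaleNr.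
    rewrite /m poly_operatorE; apply: opnorm_sqr_approx_eigenvalue => //.
      exact: peval_bounded.
    exact: peval_self_adjoint.
  have [a l_a] := self_adjoint_spectrum_real A_bd A_sa Al.
  by exists a; rewrite -l_a.
have [Qp0|/attained[a Aa /norm_attained]] := eqVneq (Q p) 0; last by exists a.
have [|a Aa _] := attained 'X.
  by rewrite /Q /P map_polyX -expr2 monic_neq0 // monicXnsubC.
by exists a => //; apply: norm_attained; rewrite Qp0 root0.
Qed.

End self_adjoint.

(** * Quadratic polynomials *)

Section quadratics.
Context {R : realType}.
Implicit Types (p : {poly R}) (a b : R).

Lemma horner_size3 p a : (size p <= 3)%N ->
  p.[a] = p`_0 + p`_1 * a + p`_2 * a ^+ 2.
Proof.
move=> /horner_coef_wide ->.
by rewrite !big_ord_recl big_ord0 /= expr0 expr1 mulr1 addr0 addrA.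
Qed.

(** p(a) - p(b) = (p_1 + p_2 (a + b)) (a - b). *)
Lemma P2_lipschitz p (M N : R) a b : P2 M p -> `|a| <= N -> `|b| <= N ->
  `|p.[a] - p.[b]| <= M * (1 + 2 * N) * `|a - b|.
Proof.
move=> [p3 pM] aN bN; rewrite !horner_size3 //.
have -> : p`_0 + p`_1 * a + p`_2 * a ^+ 2 - (p`_0 + p`_1 * b + p`_2 * b ^+ 2) =
  (p`_1 + p`_2 * (a + b)) * (a - b) by ring.
rewrite normrM ler_wpM2r // (le_trans (ler_normD _ _)) // normrM.
have abN : `|a + b| <= 2 * N by rewrite (le_trans (ler_normD _ _)) //; lra.
have N0 : 0 <= N by exact: le_trans aN.
have p0 := normr_ge0 p`_0; have p1 := normr_ge0 p`_1; have p2 := normr_ge0 p`_2.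
have := ler_wpM2l p2 abN; nra.
Qed.

(** This is L^2 - (X - a)^2, given by its coefficients because these are what
[P2] bounds. *)
Definition bump a (L : R) : {poly R} := Poly [:: L ^+ 2 - a ^+ 2; 2 * a; -1].

Lemma horner_bump a L b : (bump a L).[b] = L ^+ 2 - (b - a) ^+ 2.
Proof. by rewrite horner_Poly /=; ring. Qed.

Lemma bump_P2 a (N : R) : `|a| <= N ->
  P2 (5 * N ^+ 2 + 2 * N + 1) (bump a (2 * N)).
Proof.
move=> aN; split; first exact: size_Poly.
rewrite !coef_Poly /= normrN1 normrM ger0_norm //.
have N0 : 0 <= N by exact: le_trans aN.
have : `|(2 * N) ^+ 2 - a ^+ 2| <= 5 * N ^+ 2.
  rewrite (le_trans (ler_normB _ _)) // !normrX.
  rewrite (@ger0_norm _ (2 * N)) ?mulr_ge0 //.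
  have : `|a| ^+ 2 <= N ^+ 2 by rewrite ler_pXn2r ?nnegrE.
  lra.
lra.
Qed.
End quadratics.

(** * The Hausdorff distance of spectra and norms of polynomials *)

Section hausdorff.
Local Open Scope complex_scope.
Context {R : realType}.
Implicit Types (F G : set R[i]) (r e : R).

Lemma hausdorff_excess_le F G r :
  (forall x, F x -> exists2 y, G y & complex.Re `|x - y| <= r) ->
  (hausdorff_excess F G <= r%:E)%E.
Proof.
move=> FG; apply: ge_ereal_sup => _ [x /FG[y Gy xy] <-].
by apply: ereal_inf_le; exists (complex.Re `|x - y|)%:E => //; exists y.
Qed.

Lemma hausdorff_excess_near F G r e x :
  (hausdorff_excess F G <= r%:E)%E -> 0 < e -> F x ->
  exists2 y, G y & complex.Re `|x - y| < r + e.
Proof.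
move=> FGr e0 Fx.
have /ereal_inf_lt[_ [y Gy <-]] : (dist_set x G < (r + e)%:E)%E.
  apply: (@le_lt_trans _ _ r%:E); last by rewrite lte_fin ltrDl.
  by apply: le_trans FGr; apply: ereal_sup_ubound; exists x.
by rewrite lte_fin; exists y.
Qed.
End hausdorff.

Section comparison.
Local Open Scope complex_scope.
Context {R : realType} {H1 H2 : hilbertType R}.
Context (A1 : {linear H1 -> H1}) (A2 : {linear H2 -> H2}) (N : R).
Context (A1_bd : bounded_operator A1) (A2_bd : bounded_operator A2).
Context (A1_sa : self_adjoint A1) (A2_sa : self_adjoint A2).
Context (A1N : opnorm A1 <= N) (A2N : opnorm A2 <= N).

(** The polynomial [bump a (2 * N)] has its maximum on [-N, N] at a, where it is
(2N)^2; a point b of the second spectrum at which it reaches its norm on A2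
falls short of this value by (a - b)^2 exactly. *)
Lemma spectrum_near (e a : R) : nontrivial H2 ->
  (forall p, P2 (5 * N ^+ 2 + 2 * N + 1) p ->
     `|opnorm (poly_operator p A1) - opnorm (poly_operator p A2)| <= e) ->
  spectrum A1 a%:C -> exists2 b, spectrum A2 b%:C & (a - b) ^+ 2 <= e.
Proof.
move=> H2nt near12 A1a.
have aN : `|a| <= N by exact: le_trans (spectrum_le_opnorm A1_bd A1_sa A1a) _.
have [b A2b bp] := opnorm_attained (bump a (2 * N)) H2nt A2_bd A2_sa.
have bN : `|b| <= N by exact: le_trans (spectrum_le_opnorm A2_bd A2_sa A2b) _.
exists b => //.
have := near12 _ (bump_P2 aN); rewrite ler_norml => /andP[_].
have := horner_le_opnorm (bump a (2 * N)) A1_bd A1_sa A1a.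
rewrite -bp !horner_bump subrr expr0n subr0.
move: aN bN; rewrite !ler_norml => /andP[a1 a2] /andP[b1 b2].
have : (b - a) ^+ 2 <= (2 * N) ^+ 2.
  rewrite -[leLHS]real_normK ?num_real // ler_pXn2r ?nnegrE ?ler_norml //;
    lra.
move=> ba; rewrite !ger0_norm ?subr_ge0 ?sqr_ge0 //.
rewrite -(sqrrN (a - b)) opprB; lra.
Qed.

(** [H1] may be the zero space, where the spectrum is empty and the norm of
p(A1) is 0.  If the excess is finite and the first spectrum has a point, then
so does the second. *)
Lemma opnorm_near (M r : R) (p : {poly R}) : P2 M p -> 0 <= r ->
  (hausdorff_excess (spectrum A1) (spectrum A2) <= r%:E)%E ->
  opnorm (poly_operator p A1) <=
    opnorm (poly_operator p A2) + M * (1 + 2 * N) * r.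
Proof.
move=> pM r0 sp12.
have N0 : 0 <= N by exact: le_trans (opnorm_ge0 A1_bd) A1N.
have M0 : 0 <= M by case: pM => _; apply: le_trans; rewrite !addr_ge0.
have L0 : 0 <= M * (1 + 2 * N) by rewrite mulr_ge0 // addr_ge0 // mulr_ge0.
have n2 : 0 <= opnorm (poly_operator p A2).
  by rewrite poly_operatorE; apply: opnorm_ge0; exact: peval_bounded.
have [H1nt|H1t] := pselect (nontrivial H1); last first.
  apply: (@le_trans _ _ 0); last by rewrite addr_ge0 // mulr_ge0.
  apply: opnorm_le => // x; have [x0|xn0] := eqVneq x 0; last first.
    by exfalso; apply: H1t; exists x.
  by rewrite x0 poly_operatorE linear0 rnorm0 mulr0.
have [a A1a <-] := opnorm_attained p H1nt A1_bd A1_sa.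
have aN : `|a| <= N by exact: le_trans (spectrum_le_opnorm A1_bd A1_sa A1a) _.
(* The excess is an infimum that need not be reached; the error allowed here
   becomes at most e after multiplication by M (1 + 2 N), which may be 0. *)
apply/ler_addgt0Pr => e e0.
have [|l A2l al] := @hausdorff_excess_near _ _ _ r
    (e / (M * (1 + 2 * N) + 1)) _ sp12 _ A1a.
  by rewrite divr_gt0 // ltr_wpDl.
have [b l_b] := self_adjoint_spectrum_real A2_bd A2_sa A2l.
rewrite {}l_b -rmorphB normC_real in A2l al.
move: A2l al => A2b ab.
have bN : `|b| <= N by exact: le_trans (spectrum_le_opnorm A2_bd A2_sa A2b) _.
have pb := horner_le_opnorm p A2_bd A2_sa A2b.
have pab := P2_lipschitz pM aN bN.
have tri : `|p.[a]| <= `|p.[a] - p.[b]| + `|p.[b]|.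
  by rewrite -[leLHS](congr1 Num.norm (subrK p.[b] p.[a])) ler_normD.
have le_e : M * (1 + 2 * N) * (e / (M * (1 + 2 * N) + 1)) <= e.
  rewrite mulrA ler_pdivrMr ?ltr_wpDl // mulrC ler_wpM2l ?(ltW e0) //.
  by rewrite lerDl.
rewrite -addrA addrC (le_trans tri) // lerD // (le_trans pab) //.
by rewrite (le_trans (ler_wpM2l L0 (ltW ab))) // mulrDr lerD2l.
Qed.

End comparison.

(** * Hoelder constants as inequalities *)

Section holder_bounds.
Context {R : realType} {X : metricType R} {Y : Type}.
Context (alpha : R) (dY : Y -> Y -> \bar R).
Local Open Scope ereal_scope.

Lemma holder_const_leP (f : X -> Y) (K : R) :
  holder_const alpha dY f <= K%:E <->
  forall x y, x <> y -> dY (f x) (f y) <= (K * mdist x y `^ alpha)%:E.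
Proof.
have dpos x y : x <> y -> (0 < mdist x y `^ alpha)%R.
  by move=> /eqP xy; rewrite powR_gt0 // mdist_gt0.
split=> [fK x y xy|fK].
  rewrite EFinM -lee_pdivrMr ?dpos //; apply: le_trans fK.
  by apply: ereal_sup_ubound; exists (x, y).
apply: ge_ereal_sup => _ [[x y] /= xy <-].
by rewrite lee_pdivrMr ?dpos // -EFinM fK.
Qed.

Lemma lty_EFin_bound (x : \bar R) :
  x < +oo <-> exists2 K : R, (0 <= K)%R & x <= K%:E.
Proof.
split=> [|[K _ /le_lt_trans]]; last by apply; exact: ltry.
case: x => [r| |] // _; last by exists 0%R => //; rewrite leNye.
by exists `|r|%R => //; rewrite lee_fin ler_norm.
Qed.

Lemma holderP (f : X -> Y) : holder alpha dY f <->
  exists2 K : R, (0 <= K)%R &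
    forall x y, x <> y -> dY (f x) (f y) <= (K * mdist x y `^ alpha)%:E.
Proof.
rewrite /holder; split=> [/lty_EFin_bound|] [K K0 fK].
  by exists K => //; exact/holder_const_leP.
by apply/lty_EFin_bound; exists K => //; exact/holder_const_leP.
Qed.

Lemma uniformly_holderP (F : set (X -> Y)) : uniformly_holder alpha dY F <->
  exists2 K : R, (0 <= K)%R & forall f, F f ->
    forall x y, x <> y -> dY (f x) (f y) <= (K * mdist x y `^ alpha)%:E.
Proof.
rewrite /uniformly_holder; split=> [/lty_EFin_bound|] [K K0 FK].
  exists K => // f Ff; apply/holder_const_leP; apply: le_trans FK.
  by apply: ereal_sup_ubound; exists f.
apply/lty_EFin_bound; exists K => //; apply: ge_ereal_sup => _ [f Ff <-].
by apply/holder_const_leP; exact: FK.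
Qed.
End holder_bounds.

(** * Hoelder continuity of the spectrum and of the norms *)

Theorem theorem3 (R : realType) (T : completeMetricType R) (alpha : R)
    (alpha_gt0 : 0 < alpha) (H : T -> hilbertType R)
    (A : forall t : T, {linear H t -> H t})
    (A_bounded : forall t : T, bounded_operator (A t))
    (A_self_adjoint : forall t : T, self_adjoint (A t))
    (A_sup : has_ubound (range (fun t : T => opnorm (A t)))) :
  ((forall t : T, nontrivial (H t)) -> p2_holder alpha A ->
     holder (alpha / 2) hausdorff_dist (fun t : T => spectrum (A t))) /\
  (holder alpha hausdorff_dist (fun t : T => spectrum (A t)) ->
     p2_holder alpha A).
Proof.
have [N N0 AN] : exists2 N : R, 0 <= N & forall t, opnorm (A t) <= N.
  case: A_sup => N0 N0P; exists `|N0| => // t.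
  by apply: le_trans (ler_norm _); apply: N0P; exists t.
(* 5 N^2 + 2 N + 1 is the bound of [bump_P2]. *)
split=> [Hnt /(_ (5 * N ^+ 2 + 2 * N + 1))|/holderP[K K0 spK] M M_gt0].
- have M_gt0 : 0 < 5 * N ^+ 2 + 2 * N + 1.
    by rewrite ltr_wpDl // addr_ge0 // mulr_ge0 // exprn_ge0.
  move=> /(_ M_gt0)/uniformly_holderP[K K0 pK].
  apply/holderP; exists (Num.sqrt K) => [|x y xy]; first exact: sqrtr_ge0.
  have excess s t : s <> t ->
      (hausdorff_excess (spectrum (A s)) (spectrum (A t)) <=
       (Num.sqrt K * mdist s t `^ (alpha / 2))%:E)%E.
    move=> st; apply: hausdorff_excess_le => l Al.
    have [a l_a] :=
      self_adjoint_spectrum_real (A_bounded s) (A_self_adjoint s) Al.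
    rewrite {l}l_a in Al *.
    have near_st p : P2 (5 * N ^+ 2 + 2 * N + 1) p ->
        `|opnorm (poly_operator p (A s)) - opnorm (poly_operator p (A t))| <=
        K * mdist s t `^ alpha.
      move=> pM; rewrite -lee_fin.
      by apply: (pK (fun u => opnorm (poly_operator p (A u)))) => //; exists p.
    have [b Ab ab] := spectrum_near (A_bounded s) (A_bounded t)
      (A_self_adjoint s) (A_self_adjoint t) (AN s) (AN t) (Hnt t) near_st Al.
    exists (b%:C)%C => //; rewrite -rmorphB normC_real.
    rewrite -(@ler_pXn2r _ 2) ?nnegrE ?mulr_ge0 ?sqrtr_ge0 ?powR_ge0 //.
    rewrite exprMn sqr_sqrtr // -(@powR_mulrn _ (mdist s t `^ _)) ?powR_ge0 //.
    rewrite -powRrM divfK //.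
    by rewrite real_normK ?num_real.
  rewrite /hausdorff_dist ge_max excess //= metric_sym excess //.
  exact/nesym.
- apply/uniformly_holderP.
  exists (M * (1 + 2 * N) * K) => [|_ [p pM <-] s t st].
    by rewrite mulr_ge0 // mulr_ge0 ?addr_ge0 ?mulr_ge0 // ltW.
  have := spK _ _ st; rewrite /hausdorff_dist ge_max => /andP[st1 st2].
  have r0 : 0 <= K * mdist s t `^ alpha by rewrite mulr_ge0 ?powR_ge0.
  have h1 := opnorm_near (A_bounded s) (A_bounded t)
      (A_self_adjoint s) (A_self_adjoint t) (AN s) (AN t) pM r0 st1.
  have h2 := opnorm_near (A_bounded t) (A_bounded s)
      (A_self_adjoint t) (A_self_adjoint s) (AN t) (AN s) pM r0 st2.
  by rewrite lee_fin -mulrA ler_norml; apply/andP; split; lra.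
Qed.
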